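(* Let $R$ be a Noetherian commutative ring, and let $I\subset R$ be an ideal with $\mathrm{grade}\, I=j$. Then $$\sqrt{\mathrm{Fitt}_i(I)}=\sqrt{I}\quad\text{for}\quad i=1,\ldots,j-1.$$
   Context: For a finitely generated module $M$ over a Noetherian ring $R$, choose a finite free presentation $G\to F\to M\to 0$ with $\mathrm{rank}\,F=r$, and let $A$ be a matrix representing $G\to F$. The $j$th Fitting ideal of $M$ is $\mathrm{Fitt}_j(M)=I_{r-j}(A)$, where $I_t(A)$ is the ideal generated by the $t$-minors of $A$, with $I_t(A)=R$ for $t\le 0$. This is independent of the choices. An ideal $I$ is regarded as an $R$-module. $\mathrm{grade}\,I$ is the length of a maximal $R$-regular sequence contained in $I$. *)

(* Defs.v *)
From HB Require Import structures.
From mathcomp Require Import all_boot all_order all_algebra.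
From mathcomp Require Import boolp classical_sets.

Set Implicit Arguments.
Unset Strict Implicit.
Unset Printing Implicit Defensive.

Import GRing.Theory.
Local Open Scope classical_set_scope.
Local Open Scope ring_scope.

(* A submodule, given as a predicate on its ambient module, as a module in its
   own right. *)
Definition submod_type (R : pzRingType) (V : lmodType R) (S : submodClosed V)
  : Type := {x : V | x \in S}.

HB.instance Definition _ (R : pzRingType) (V : lmodType R)
  (S : submodClosed V) := SubChoice.on (submod_type S).
HB.instance Definition _ (R : pzRingType) (V : lmodType R)
  (S : submodClosed V) := [SubChoice_isSubLmodule of submod_type S by <:].

(* The ideals of a commutative ring R, namely the submodules of R^o; the unit
   ideal is included. *)
Notation ideal R := (submodClosed R^o).

Section CommutativeRing.
Variable R : comPzRingType.

Definition gen_ideal (S : set R) : set R :=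
  [set x | exists (n : nat) (c s : 'I_n -> R),
     (forall k, S (s k)) /\ x = \sum_(k < n) c k * s k].

Definition noetherian : Prop :=
  forall J : ideal R, exists s : seq R, [set` J] = gen_ideal [set` s].

Definition radical (S : set R) : set R :=
  [set x | exists n : nat, S (x ^+ n)].

(* Each entry is a nonzerodivisor modulo the ideal generated by the previous
   ones, and the quotient of R by all of them is nonzero. *)
Definition regular_seq (s : seq R) : Prop :=
  (forall k, (k < size s)%N -> forall y,
     gen_ideal [set` take k s] (s`_k * y) -> gen_ideal [set` take k s] y) /\
  ~ gen_ideal [set` s] 1.

Definition maximal_regular_seq (J : ideal R) (s : seq R) : Prop :=
  [/\ regular_seq s, {subset s <= J} &
      forall x, x \in J -> ~ regular_seq (rcons s x)].

Definition has_grade (J : ideal R) (j : nat) : Prop :=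
  exists2 s : seq R, maximal_regular_seq J s & size s = j.

(* I_t(A); for t = 0 the only minor is the empty determinant 1, so that
   I_0(A) = R. *)
Definition minors_ideal (m n : nat) (t : nat) (A : 'M[R]_(m, n)) : set R :=
  gen_ideal [set x | exists (f : 'I_t -> 'I_m) (g : 'I_t -> 'I_n),
    [/\ {homo f : a b / (a < b)%N}, {homo g : a b / (a < b)%N} &
        x = \det (mxsub f g A)]].

(* R^m -> R^r -> M -> 0 exact. Free modules consist of row vectors, so the
   first map is u |-> u *m A and the rows of A are the relations. *)
Record presentation (M : lmodType R) := Presentation {
  pres_rank : nat;
  pres_nrel : nat;
  pres_mx : 'M[R]_(pres_nrel, pres_rank);
  pres_map : {linear 'rV[R]_pres_rank -> M};
  pres_surj : forall x : M, exists v, pres_map v = x;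
  pres_exact : forall v, pres_map v = 0 <-> exists u, v = u *m pres_mx
}.

(* Computed from a chosen presentation (the value is irrelevant if M has none).
   When the rank is at most j, the truncated subtraction gives I_0 = R. *)
Definition Fitt (j : nat) (M : lmodType R) : set R :=
  xget set0 [set J | exists P : presentation M,
    J = minors_ideal (pres_rank P - j) (pres_mx P)].

End CommutativeRing.

Arguments noetherian R : clear implicits.

(* Main.v *)
Require Import Defs.
From HB Require Import structures.
From mathcomp Require Import all_boot all_order all_algebra.
From mathcomp Require Import boolp classical_sets.
From mathcomp Require Import perm ring zify.

Set Implicit Arguments.
Unset Strict Implicit.
Unset Printing Implicit Defensive.

Import GRing.Theory.
Local Open Scope classical_set_scope.
Local Open Scope ring_scope.

(** Fix a presentation of I with matrix A, rank r and generators a_1, ..., a_r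
    of I. Both inclusions are checked on generators.

    I is contained in the radical of Fitt_i(I) when i >= 1: after inverting a_k
    the ideal becomes free of rank one, so Fitt_1(I) becomes R. Without
    localizing, the Koszul relations a_k e_l - a_l e_k are combinations of the
    rows of A, and a principal minor of the matrix of these relations that
    avoids the index k is a power of a_k; by the Cauchy-Binet argument
    ([minor_mulmx]) this power lies in the ideal of minors of A. This is
    [generator_power_minor].

    Conversely, let D be a minor of A of size r - i with columns g, where
    i < j. Cramer's rule applied to A a = 0 gives D I <= Y, where Y is generated
    by the at most i elements a_l with l outside g ([minor_mul_gen]). Hence
    after inverting D the ideal I is generated by fewer elements than the length
    j of a regular sequence s that it contains, and this forces it to be the
    unit ideal: a power of D lies in Y, hence in I ([radical_of_regular_seq]).

    The last step is the depth-sensitivity of the Koszul complex K of the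
    generators of Y, a complex of length n < j: each element of Y acts on K by a
    map that is homotopic to zero, so by induction along the regular sequence
    the cohomology of K vanishes in the degrees below j, including the top
    degree n, where it is R / Y. No localization is formed: the statement that
    something holds after inverting D is expressed by multiplying with a power
    of D, and the ideals generated by initial parts of s are replaced by their
    saturations with respect to D.

    The value of Fitt_i(I) refers to a chosen presentation; one exists because
    submodules of free modules of finite rank over a Noetherian ring are
    finitely generated ([noetherian_submod]). *)

(** * Ideals and radicals *)

Section Ideals.
Variable R : comPzRingType.
Implicit Types (J : set R) (x y a : R).

(** Ideals of minors, radicals and saturations are sets with values in [Prop],
    so being an ideal is a property here, not a structure. *)
Definition is_ideal J : Prop :=
  [/\ J 0, forall x y, J x -> J y -> J (x + y) & forall a x, J x -> J (a * x)].

Lemma ideal0 J : is_ideal J -> J 0. Proof. by case. Qed.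

Lemma idealD J x y : is_ideal J -> J x -> J y -> J (x + y).
Proof. by case=> _ + _; apply. Qed.

Lemma idealMl J a x : is_ideal J -> J x -> J (a * x).
Proof. by case=> _ _; apply. Qed.

Lemma idealB J x y : is_ideal J -> J x -> J y -> J (x - y).
Proof.
by move=> idJ Jx Jy; rewrite -mulN1r; apply: idealD => //; apply: idealMl.
Qed.

Lemma ideal_sum J (T : Type) (r : seq T) (P : pred T) (F : T -> R) :
  is_ideal J -> (forall i, P i -> J (F i)) -> J (\sum_(i <- r | P i) F i).
Proof.
move=> idJ JF; apply: big_ind => //; first exact: ideal0.
by move=> x y; apply: idealD.
Qed.

Lemma is_ideal_submod (I : ideal R) : is_ideal [set` I].
Proof.
split=> /= [|x y|a x]; first exact: (@rpred0 R^o).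
- exact: (@rpredD R^o).
- exact: (@rpredZ R R^o).
Qed.

Lemma mem_gen_ideal (S : set R) x : S x -> gen_ideal S x.
Proof.
move=> Sx; exists 1%N, (fun=> 1), (fun=> x); split=> //.
by rewrite big_ord1 mul1r.
Qed.

Lemma gen_ideal_min (S J : set R) :
  is_ideal J -> (forall x, S x -> J x) -> forall x, gen_ideal S x -> J x.
Proof.
move=> idJ SJ x [n [c [s [Ss ->]]]]; apply: ideal_sum => // k _.
by apply: idealMl => //; apply/SJ/Ss.
Qed.

Lemma is_ideal_gen (S : set R) : is_ideal (gen_ideal S).
Proof.
split=> [|x y [m [c [s [Ss ->]]]] [n [d [t [St ->]]]]|a x [n [c [s [Ss ->]]]]].
- by exists 0%N, (fun=> 0), (fun=> 0); split=> [[]|] //; rewrite big_ord0.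
- pose glue T (f : 'I_m -> T) (g : 'I_n -> T) k :=
    match split k with inl i => f i | inr i => g i end.
  exists (m + n)%N, (glue _ c d), (glue _ s t); split=> [k|].
    by rewrite /glue; case: splitP.
  rewrite big_split_ord /=; congr (_ + _); apply: eq_bigr => i _.
    by rewrite /glue (unsplitK (inl i)).
  by rewrite /glue (unsplitK (inr i)).
- exists n, (fun k => a * c k), s; split=> //.
  by rewrite mulr_sumr; apply: eq_bigr => k _; rewrite mulrA.
Qed.

Lemma gen_ideal_seqP (s : seq R) x :
  gen_ideal [set` s] x <->
  exists c : nat -> R, x = \sum_(k < size s) c k * s`_k.
Proof.
split=> [|[c ->]]; last first.
  apply: ideal_sum => [|k _]; first exact: is_ideal_gen.
  apply: idealMl; first exact: is_ideal_gen.
  by apply: mem_gen_ideal; apply: mem_nth.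
pose J := [set z | exists c : nat -> R,
  z = \sum_(k < size s) c k * s`_k].
apply: (@gen_ideal_min _ J) => [|{}x /= /(nthP 0)[k ltk <-]].
  split=> [|_ _ [c ->] [d ->]|a _ [c ->]].
  - by exists (fun=> 0); rewrite big1 // => k _; rewrite mul0r.
  - exists (fun k => c k + d k).
    by rewrite -big_split; apply: eq_bigr => k _; rewrite mulrDl.
  - exists (fun k => a * c k).
    by rewrite mulr_sumr; apply: eq_bigr => k _; rewrite mulrA.
exists (fun l => (l == k)%:R).
rewrite (bigD1 (Ordinal ltk)) //= eqxx mul1r big1 ?addr0 // => l.
by rewrite -val_eqE /= => /negPf->; rewrite mul0r.
Qed.

Lemma is_ideal_radical J : is_ideal J -> is_ideal (radical J).
Proof.
move=> idJ; split=> [|x y [m Jx] [n Jy]|a x [n Jx]].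
- by exists 1%N; rewrite expr1; apply: ideal0.
- exists (m + n)%N; rewrite exprDn; apply: ideal_sum => // k _.
  rewrite -mulr_natl; apply: idealMl => //.
  (* In each term either the exponent of y is at least n, or that of x at
     least m. *)
  have [lenk|/ltnW lekn] := leqP n k.
    by rewrite -(subnK lenk) exprD mulrA; apply: idealMl.
  by rewrite -addnBA // addnC exprD mulrAC; apply: idealMl.
- by exists n; rewrite exprMn; apply: idealMl.
Qed.

Lemma radical_radical J x : radical (radical J) x -> radical J x.
Proof. by case=> m [n Jx]; exists (m * n)%N; rewrite exprM. Qed.

End Ideals.

(** * Finite presentations over a Noetherian ring *)

Section Presentations.
Variable R : comPzRingType.
Hypothesis noethR : noetherian R.

Lemma noetherian_ideal (J : set R) :
  is_ideal J -> exists s : seq R, J = gen_ideal [set` s].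
Proof.
move=> idJ.
pose P : {pred R^o} := [pred x : R^o | `[< J x >]].
have submodP : submod_closed P.
  split; first by apply: asboolT; apply: ideal0.
  move=> a x y /asboolW Jx /asboolW Jy; apply: asboolT.
  exact: idealD idJ (idealMl a idJ Jx) Jy.
pose PI : ideal R :=
  HB.pack_for (ideal R) P (GRing.isSubmodClosed.Build R R^o P submodP).
have [s eqs] := noethR PI; exists s; rewrite -eqs.
by apply/seteqP; split=> x /= /asboolP.
Qed.

(** Induction on the rank: the first coordinates of the elements of S form an
    ideal. Lift finitely many generators of it to S (the matrix B), and add
    generators of the submodule of the elements with first coordinate 0. *)
Lemma noetherian_submod n (S : set 'rV[R]_n) :
  S 0 -> (forall u v, S u -> S v -> S (u + v)) ->
  (forall a v, S v -> S (a *: v)) ->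
  exists m (A : 'M[R]_(m, n)), forall v, S v <-> exists u, v = u *m A.
Proof.
elim: n S => [|n IHn] S S0 SD SZ.
  exists 0%N, 0 => v; rewrite [v]thinmx0.
  by split=> // _; exists 0; rewrite mul0mx.
pose J := [set x | exists w : 'rV_n, S (row_mx x%:M w)].
have idJ : is_ideal J.
  split=> [|x y [v Sv] [w Sw]|a x [v Sv]].
  - by exists 0; rewrite raddf0 row_mx0.
  - by exists (v + w); rewrite raddfD -add_row_mx; apply: SD.
  - by exists (a *: v); rewrite -scale_scalar_mx -scale_row_mx; apply: SZ.
have [s Js] := noetherian_ideal idJ.
have /choice[w Sw] (k : 'I_(size s)) : exists w, S (row_mx (s`_k)%:M w).
  by change (J s`_k); rewrite Js; apply/mem_gen_ideal/mem_nth.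
have [|u v|a v|m [A SA]] := IHn [set v | S (row_mx (0 : 'rV_1) v)].
- by rewrite /= row_mx0.
- by move=> /= Su Sv; rewrite -[0]addr0 -add_row_mx; apply: SD.
- by move=> /= Sv; rewrite -[0](scaler0 _ a) -scale_row_mx; apply: SZ.
pose B : 'M_(size s, 1 + n) := \matrix_k row_mx (s`_k)%:M (w k).
have SB c : S (c *m B).
  rewrite mulmx_sum_row; apply: big_ind => // k _.
  by apply: SZ; rewrite rowK.
pose A0 : 'M_(m, 1 + n) := row_mx 0 A.
have mulA0 u : u *m A0 = row_mx 0 (u *m A) :> 'rV_(1 + n).
  by rewrite mul_mx_row mulmx0.
exists (size s + m)%N, (col_mx B A0) => v; split=> [Sv|[u ->]].
  have /gen_ideal_seqP[c vE] : gen_ideal [set` s] (v 0 0).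
    rewrite -Js; exists (@rsubmx _ 1 1 n v).
    have -> : (v 0 0)%:M = @lsubmx _ 1 1 n v.
      by rewrite [RHS]mx11_scalar mxE; congr (v _ _)%:M; apply: val_inj.
    by rewrite hsubmxK.
  pose C : 'rV_(size s) := \row_k c k.
  (* Subtracting C *m B clears the first coordinate of v. *)
  have SvB : S (v - C *m B) by rewrite -scaleN1r; apply/SD/SZ/SB.
  have vB : v - C *m B = row_mx (0 : 'rV_1) (@rsubmx _ 1 1 n (v - C *m B)).
    apply: etrans (esym (@hsubmxK _ 1 1 n _)) _; congr row_mx.
    apply/matrixP=> i j; rewrite !ord1 !mxE.
    have -> : @lshift 1 n 0 = 0 :> 'I_n.+1 by apply: val_inj.
    rewrite vE; apply/eqP; rewrite subr_eq0; apply/eqP/eq_bigr => k _.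
    by rewrite !mxE; case: splitP => // j0 _; rewrite !ord1 mxE.
  have /SA[u uE] : S (row_mx (0 : 'rV_1) (@rsubmx _ 1 1 n (v - C *m B))).
    by rewrite -vB.
  exists (row_mx C u); rewrite mul_row_col mulA0 -uE -vB.
  by rewrite addrC subrK.
rewrite -[u]hsubmxK mul_row_col; apply: SD => //.
by rewrite mulA0; apply/SA; exists (rsubmx u).
Qed.

End Presentations.

Section LinComb.
Variables (R : comPzRingType) (V : lmodType R) (n : nat) (x : 'I_n -> V).

Definition lin_comb (v : 'rV[R]_n) : V := \sum_(l < n) v 0 l *: x l.

Lemma lin_comb_is_linear : linear lin_comb.
Proof.
move=> a u v; rewrite /lin_comb scaler_sumr -big_split.
by apply: eq_bigr => l _; rewrite !mxE scalerDl scalerA.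
Qed.
HB.instance Definition _ := GRing.isLinear.Build R _ _ _ lin_comb
  lin_comb_is_linear.

End LinComb.

Lemma presentation_exists (R : comPzRingType) (noethR : noetherian R)
  (I : ideal R) : inhabited (presentation (submod_type I)).
Proof.
have [s Is] := noethR I.
have sI (k : 'I_(size s)) : s`_k \in I.
  by change ([set` I] s`_k); rewrite Is; apply/mem_gen_ideal/mem_nth.
pose x (k : 'I_(size s)) : submod_type I := exist _ s`_k (sI k).
have surj z : exists v, lin_comb x v = z.
  have : [set` I] (val z) by apply: (valP z).
  rewrite Is => /gen_ideal_seqP[c zE]; exists (\row_k c k).
  apply: val_inj; rewrite zE /lin_comb raddf_sum.
  by apply: eq_bigr => k _; rewrite mxE.
have [|u v|a v|m [A kerA]] :=
  noetherian_submod noethR (S := [set v | lin_comb x v = 0]).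
- by rewrite /= raddf0.
- by move=> /= u0 v0; rewrite raddfD /= u0 v0 addr0.
- by move=> /= v0; rewrite linearZ /= v0 scaler0.
exact: inhabits (Presentation surj kerA).
Qed.

(** * Minors and Cramer's rule *)

Section Minors.
Variable R : comPzRingType.

Lemma sort_injection t m (h : 'I_t -> 'I_m) : injective h ->
  exists (f : 'I_t -> 'I_m) (p : 'S_t),
    {homo f : a b / (a < b)%N} /\ h =1 f \o p.
Proof.
move=> injh; pose leT (x y : 'I_m) := (x <= y)%N.
pose u := [tuple of sort leT [tuple h i | i < t]].
have u_uniq : uniq u by rewrite sort_uniq map_inj_uniq ?enum_uniq.
have u_sorted : sorted leT u.
  exact: sort_sorted (fun x y : 'I_m => leq_total x y) _.
have /tuple_permP[p hp] : perm_eq [tuple h i | i < t] u.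
  by rewrite perm_sym perm_sort.
exists (tnth u), p; split=> [a b lt_ab|i] /=; last first.
  by have /(congr1 (@tnth _ _ ^~ i)) := val_inj hp; rewrite !tnth_mktuple.
have x0 := h a; rewrite !(tnth_nth x0) ltn_neqAle.
rewrite (inj_eq (@ord_inj m)) nth_uniq ?size_tuple ?(ltn_eqF lt_ab) //=.
apply: (sorted_ltn_nth _ x0 u_sorted) => //; rewrite ?inE ?size_tuple //.
by move=> y x z; apply: leq_trans.
Qed.

(** Permuting rows changes a minor by a sign, and a repeated row makes it 0;
    the Cauchy-Binet expansion produces rows in any order. *)
Lemma minor_unsorted_rows m n t (A : 'M[R]_(m, n)) (h : 'I_t -> 'I_m)
    (g : 'I_t -> 'I_n) :
  {homo g : a b / (a < b)%N} -> minors_ideal t A (\det (mxsub h g A)).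
Proof.
move=> homog; have [/injectiveP injh|/injectivePn[i [i' ii' hii']]] :=
  boolP (injectiveb h); last first.
  rewrite (determinant_alternate ii') => [|k]; last by rewrite !mxE hii'.
  by apply: ideal0; apply: is_ideal_gen.
have [f [p [homof hfp]]] := sort_injection injh.
have -> : mxsub h g A = row_perm p (mxsub f g A).
  by apply/matrixP=> i k; rewrite !mxE hfp.
rewrite row_permE det_mulmx; apply: idealMl; first exact: is_ideal_gen.
by apply: mem_gen_ideal; exists f, g.
Qed.

(** Cauchy-Binet before the choices of rows with the same image are grouped. *)
Lemma det_mulmx_rect t m (M : 'M[R]_(t, m)) (N : 'M[R]_(m, t)) :
  \det (M *m N) =
  \sum_(h : {ffun 'I_t -> 'I_m}) (\prod_i M i (h i)) * \det (rowsub h N).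
Proof.
pose MN (s : 'S_t) i k := M i k * N k (s i).
transitivity (\sum_(s : 'S_t) \sum_(h : {ffun 'I_t -> 'I_m})
                (-1) ^+ s * \prod_i MN s i (h i)).
  apply: eq_bigr => s _; rewrite -big_distrr /= -(bigA_distr_bigA (MN s)) /=.
  by congr (_ * _); apply: eq_bigr => i _; rewrite mxE.
rewrite exchange_big; apply: eq_bigr => h _ /=.
rewrite mulr_sumr; apply: eq_bigr => s _.
rewrite big_split mulrCA; congr (_ * (_ * _)).
by apply: eq_bigr => i _; rewrite mxE.
Qed.

Lemma minor_mulmx p m n t (U : 'M[R]_(p, m)) (A : 'M[R]_(m, n))
    (f : 'I_t -> 'I_p) (g : 'I_t -> 'I_n) :
  {homo g : a b / (a < b)%N} ->
  minors_ideal t A (\det (mxsub f g (U *m A))).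
Proof.
move=> homog; rewrite mxsub_mul det_mulmx_rect.
apply: ideal_sum => [|h _]; first exact: is_ideal_gen.
apply: idealMl; first exact: is_ideal_gen.
by rewrite -mxsub_comp; apply: minor_unsorted_rows.
Qed.

(** Cramer's rule: multiplying the rows [f] of A a = 0 by the adjugate of
    the submatrix expresses D a_k, for each column k of the minor D, through
    the entries of a outside these columns. *)
Lemma minor_mul_gen m r t (A : 'M[R]_(m, r)) (a : 'I_r -> R)
    (f : 'I_t -> 'I_m) (g : 'I_t -> 'I_r) :
  (forall i, \sum_l A i l * a l = 0) ->
  forall k, gen_ideal [set` [seq a l | l <- enum [predC codom g]]]
    (\det (mxsub f g A) * a k).
Proof.
move=> Aa0 k; set Y := gen_ideal _; set D := \det _.
have idY : is_ideal Y by apply: is_ideal_gen.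
have Ya l : l \notin codom g -> Y (a l).
  by move=> gl; apply: mem_gen_ideal; apply: map_f; rewrite mem_enum.
have [/codomP[q ->]|gk] := boolP (k \in codom g); last first.
  by apply: idealMl => //; apply: Ya.
pose C := \adj (mxsub f g A) *m rowsub f A.
have Cg q' : C q (g q') = D *+ (q == q').
  transitivity (colsub g C q q'); first by rewrite [RHS]mxE.
  by rewrite -mulmx_colsub -mxsub_comp mul_adj_mx mxE.
have Ca : \sum_l C q l * a l = 0.
  under eq_bigr do rewrite mxE mulr_suml.
  rewrite exchange_big big1 // => i _ /=.
  under eq_bigr do rewrite [rowsub _ _ _ _]mxE -mulrA.
  by rewrite -mulr_sumr Aa0 mulr0.
have -> : D * a (g q) = - \sum_(l | l != g q) C q l * a l.
  apply/eqP; rewrite -addr_eq0; apply/eqP.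
  by move: Ca; rewrite (bigD1 (g q)) //= Cg eqxx mulr1n.
rewrite -mulN1r; apply: idealMl => //; apply: ideal_sum => // l lgq.
have [/codomP[q' lE]|gl] := boolP (l \in codom g).
  rewrite lE Cg; have [qq'|_] := eqVneq q q'.
    by rewrite lE qq' eqxx in lgq.
  by rewrite mul0r; apply: ideal0.
by apply: idealMl => //; apply: Ya.
Qed.

(** Row i of U *m A below is a_k e_i - a_i e_k; on rows and columns other than k
    this matrix is a_k times the identity. *)
Lemma generator_power_minor m r t (A : 'M[R]_(m, r)) (a : 'I_r -> R) :
  (forall i k, exists u : 'rV_m,
     a k *: delta_mx 0 i - a i *: delta_mx 0 k = u *m A) ->
  (t < r)%N -> forall k, minors_ideal t A (a k ^+ t).
Proof.
case: r A a => // r A a koszul ltr k.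
have /choice[u uE] := koszul ^~ k.
pose U := \matrix_i u i.
pose f (q : 'I_t) : 'I_r.+1 := lift k (widen_ord (ltr : t <= r)%N q).
have homof : {homo f : p q / (p < q)%N}.
  by move=> p q ltpq; rewrite /f /= ltnNge leq_bump2 -ltnNge.
have := minor_mulmx U A f homof.
suff -> : mxsub f f (U *m A) = (a k)%:M by rewrite det_scalar.
apply/matrixP=> p q; rewrite !mxE.
have -> : \sum_j U (f p) j * A j (f q) = (u (f p) *m A) 0 (f q).
  by rewrite mxE; apply: eq_bigr => l _; rewrite mxE.
rewrite -uE !mxE eqxx /= [f q == k]eq_sym (negPf (neq_lift _ _)) mulr0 subr0.
by rewrite mulr_natr (inj_eq lift_inj) eq_sym.
Qed.

End Minors.

(** * The Koszul complex *)

Section Koszul.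
Variables (R : comPzRingType) (y : nat -> R).

(** The exterior algebra of R^n, split by whether the last basis vector occurs:
    (u, v) stands for u + e_n v. With this encoding exterior and interior
    multiplication have explicit recursive formulas, and congruences can be
    checked coefficient by coefficient. *)
Fixpoint ext n : lmodType R :=
  if n is n'.+1 then (ext n' * ext n')%type else R^o.

(** Exterior multiplication by the vector y: the Koszul differential. *)
Fixpoint wedge n : ext n -> ext n :=
  if n is n'.+1 return ext n -> ext n then
    fun w => (wedge w.1, y n' *: w.1 - wedge w.2)
  else fun=> 0.

(** Interior multiplication by the linear form c. *)
Fixpoint contract (c : nat -> R) n : ext n -> ext n :=
  if n is n'.+1 return ext n -> ext n then
    fun w => (contract c w.1 + c n' *: w.2, - contract c w.2)
  else fun=> 0.

Lemma wedge_is_linear n : linear (@wedge n).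
Proof.
elim: n => [|n IHn] a u v /=; first by rewrite scaler0 addr0.
rewrite !IHn /=; congr pair.
rewrite -[RHS]/(a *: (y n *: u.1 - wedge u.2) + (y n *: v.1 - wedge v.2)).
by rewrite scalerDr scalerBr !scalerA [y n * a]mulrC opprD addrACA.
Qed.
HB.instance Definition _ n := GRing.isLinear.Build R (ext n) (ext n) _
  (@wedge n) (@wedge_is_linear n).

Lemma wedgeB n (u v : ext n) : wedge (u - v) = wedge u - wedge v.
Proof. exact: linearB. Qed.

Lemma wedgeZ n a (u : ext n) : wedge (a *: u) = a *: wedge u.
Proof. exact: linearZ. Qed.

Lemma wedge_wedge n (w : ext n) : wedge (wedge w) = 0.
Proof.
elim: n w => //= n IHn w.
by rewrite linearB linearZ /= !IHn subr0 subrr.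
Qed.

Lemma contract_is_linear c n : linear (@contract c n).
Proof.
elim: n => [|n IHn] a u v /=; first by rewrite scaler0 addr0.
rewrite !IHn /=; congr pair.
  rewrite -[RHS]/(a *: (contract c u.1 + c n *: u.2) +
                  (contract c v.1 + c n *: v.2)).
  by rewrite !scalerDr !scalerA [c n * a]mulrC addrACA.
by rewrite -[RHS]/(a *: - contract c u.2 - contract c v.2) scalerN opprD.
Qed.
HB.instance Definition _ c n := GRing.isLinear.Build R (ext n) (ext n) _
  (@contract c n) (@contract_is_linear c n).

(** Cartan's homotopy formula: the value of the form c at y, an arbitrary
    element of the ideal generated by y, acts on the Koszul complex by a map
    homotopic to zero. *)
Lemma contract_wedge c n (w : ext n) :
  wedge (contract c w) + contract c (wedge w) =
  (\sum_(l < n) c l * y l) *: w.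
Proof.
elim: n w => [|n IHn] w /=; first by rewrite big_ord0 scale0r addr0.
case: w => u v; rewrite big_ord_recr /=; congr pair => /=.
  rewrite linearD linearZ /= scalerBr scalerDl -IHn scalerA.
  by rewrite addrACA [_ *: wedge v + _]addrC subrK.
rewrite linearN linearB linearZ /= opprK opprB scalerDr scalerDl -IHn !scalerA.
rewrite [y n * c n]mulrC [_ + wedge _]addrAC.
by rewrite [LHS]addrC !addrA subrK [contract _ _ + _]addrC.
Qed.

(** The ideal prescribed for a coefficient depends on its degree. A constant
    family expresses congruence to 0 modulo an ideal, and a family that is zero
    from some degree on bounds the degree ([deg_lt]). *)
Fixpoint coef_in (J : nat -> set R) n : ext n -> Prop :=
  if n is n'.+1 return ext n -> Prop then
    fun w => coef_in J w.1 /\ coef_in (J \o succn) w.2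
  else fun w => J 0%N w.

Lemma coef_in0 J n : (forall p, is_ideal (J p)) -> coef_in J (0 : ext n).
Proof.
elim: n J => [|n IHn] J idJ /=; first exact: (ideal0 (idJ 0%N)).
by split; apply: IHn => // p; apply: (idJ p.+1).
Qed.

Lemma coef_inD J n (u v : ext n) : (forall p, is_ideal (J p)) ->
  coef_in J u -> coef_in J v -> coef_in J (u + v).
Proof.
elim: n J u v => [|n IHn] J u v idJ /=; first exact: (idealD (idJ 0%N)).
by case=> u1 u2 [v1 v2]; split; apply: IHn => // p; apply: (idJ p.+1).
Qed.

Lemma coef_inZ J n a (u : ext n) : (forall p, is_ideal (J p)) ->
  coef_in J u -> coef_in J (a *: u).
Proof.
elim: n J u => [|n IHn] J u idJ /=; first exact: (idealMl _ (idJ 0%N)).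
by case=> u1 u2; split; apply: IHn => // p; apply: (idJ p.+1).
Qed.

Lemma coef_inB J n (u v : ext n) : (forall p, is_ideal (J p)) ->
  coef_in J u -> coef_in J v -> coef_in J (u - v).
Proof.
by move=> idJ Ju Jv; rewrite -scaleN1r; apply: coef_inD => //; apply: coef_inZ.
Qed.

Lemma coef_inN J n (u : ext n) : (forall p, is_ideal (J p)) ->
  coef_in J u -> coef_in J (- u).
Proof. by move=> idJ Ju; rewrite -scaleN1r; apply: coef_inZ. Qed.

Lemma coef_in_contract J c n (w : ext n) : (forall p, is_ideal (J p)) ->
  coef_in J w -> coef_in (J \o succn) (contract c w).
Proof.
elim: n J w => [|n IHn] J w idJ /=; first by move=> _; exact: ideal0 (idJ 1%N).
have idSJ p : is_ideal ((J \o succn) p) by apply: idJ.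
case=> w1 w2; split.
  apply: (coef_inD idSJ); first exact: IHn.
  exact: (coef_inZ _ idSJ).
by apply: coef_inN => [p|]; [apply: (idJ p.+2)|apply: IHn].
Qed.

Lemma coef_in_wedge (J : set R) n (w : ext n) : is_ideal J ->
  coef_in (fun=> J) w -> coef_in (fun=> J) (wedge w).
Proof.
move=> idJ; elim: n w => [|n IHn] w /=; first by move=> _; exact: (ideal0 idJ).
case=> w1 w2; split; first exact: IHn.
apply: coef_inB => //; last exact: IHn.
exact: coef_inZ.
Qed.

Lemma coef_in_cancel (J : set R) x n (w : ext n) :
  (forall z, J (x * z) -> J z) ->
  coef_in (fun=> J) (x *: w) -> coef_in (fun=> J) w.
Proof.
move=> Jx; elim: n w => [|n IHn] w /=; first exact: Jx.
by case=> /IHn w1 /IHn w2.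
Qed.

(** After inverting D, the ideal J' is contained in J + (x). *)
Definition extend_by D (J J' : set R) x :=
  forall z, J' z -> exists t w, J (D ^+ t * z - x * w).

Lemma coef_in_extend D (J J' : set R) x n (w : ext n) :
  is_ideal J -> extend_by D J J' x -> coef_in (fun=> J') w ->
  exists t v, coef_in (fun=> J) (D ^+ t *: w - x *: v).
Proof.
move=> idJ JJ'; elim: n w => [|n IHn] w /=; first exact: JJ'.
case=> /IHn[s [u Ju]] /IHn[t [v Jv]].
exists (s + t)%N, (D ^+ t *: u, D ^+ s *: v); split=> /=.
  have -> : D ^+ (s + t) *: w.1 - x *: (D ^+ t *: u) =
      D ^+ t *: (D ^+ s *: w.1 - x *: u).
    by rewrite scalerBr !scalerA exprD [D ^+ s * _]mulrC [x * _]mulrC.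
  exact: coef_inZ.
have -> : D ^+ (s + t) *: w.2 - x *: (D ^+ s *: v) =
    D ^+ s *: (D ^+ t *: w.2 - x *: v).
  by rewrite scalerBr !scalerA exprD [x * _]mulrC.
exact: coef_inZ.
Qed.

Lemma coef_in_sub (J J' : nat -> set R) n (w : ext n) :
  (forall p z, J p z -> J' p z) -> coef_in J w -> coef_in J' w.
Proof.
elim: n J J' w => [|n IHn] J J' w JJ' /=; first exact: JJ'.
case=> w1 w2; split; first exact: IHn w1.
by apply: IHn w2 => p z; apply: JJ'.
Qed.

Lemma coef_in_multiple (J : set R) x n (w : ext n) :
  (forall z, J (x * z)) -> coef_in (fun=> J) (x *: w).
Proof.
move=> Jx; elim: n w => [|n IHn] w /=; first exact: Jx.
by split; apply: IHn.
Qed.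

Definition deg_lt p n (w : ext n) :=
  coef_in (fun q => [set z : R | (q < p)%N \/ z = 0]) w.

Lemma is_ideal_deg_lt p q : is_ideal [set z : R | (q < p)%N \/ z = 0].
Proof.
split=> /= [|u v [ltqp _|->]|a u [ltqp|->]]; try by [left|right].
- by rewrite add0r.
- by rewrite mulr0; right.
Qed.

Lemma deg_lt_ext n (w : ext n) : deg_lt n.+1 w.
Proof.
suff H m : (n < m)%N -> deg_lt m w by apply: H.
rewrite /deg_lt; elim: n m w => [|n IHn] [|m] w //= ltnm; first by left.
by split; [apply: IHn; apply: ltnW|apply: (IHn m)].
Qed.

(** Think of J k as the ideal generated by x_0, ..., x_(k-1) after inverting D.
    A Koszul cocycle modulo J k of degree less than p is a coboundary modulo
    J k, up to a power of D, if the regular sequence has p entries from k on.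
    The induction lowers the degree p and raises k: if b is a cocycle modulo
    J k, then its contraction b' satisfies wedge b' = x_k b modulo J k, so it is
    a cocycle modulo J (k+1), hence a coboundary there; writing
    b' = wedge w + x_k v and applying wedge gives x_k b = x_k (wedge v) modulo
    J k, and x_k can be cancelled. *)
Lemma koszul_exact D (J : nat -> set R) (x : nat -> R) (c : nat -> nat -> R)
    m n :
  (forall k, is_ideal (J k)) ->
  (forall k, (k < m)%N -> x k = \sum_(l < n) c k l * y l) ->
  (forall k, (k < m)%N -> forall z, J k (x k * z) -> J k z) ->
  (forall k, (k < m)%N -> forall z, J k z -> J k.+1 z) ->
  (forall k, (k < m)%N -> forall z, J k.+1 (x k * z)) ->
  (forall k, (k < m)%N -> extend_by D (J k) (J k.+1) (x k)) ->
  forall p k (b : ext n), (k + p <= m)%N -> deg_lt p b ->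
  coef_in (fun=> J k) (wedge b) ->
  exists t w, coef_in (fun=> J k) (D ^+ t *: b - wedge w).
Proof.
move=> idJ xE regx JS JxS extJ; elim=> [|p IHp] k b lekpm degb Jdb.
  exists 0%N, 0; rewrite expr0 scale1r raddf0 subr0.
  by apply: coef_in_sub degb => q z [//|->]; apply: ideal0.
have ltkm : (k < m)%N by apply: leq_trans lekpm; rewrite addnS ltnS leq_addr.
pose b' := contract (c k) b.
have hom : wedge b' + contract (c k) (wedge b) = x k *: b.
  by rewrite contract_wedge -xE.
have Jcdb : coef_in (fun=> J k) (contract (c k) (wedge b)).
  exact: (coef_in_contract (J := fun=> J k)).
have [|||t [w Jw]] := IHp k.+1 b'.
- by rewrite addSnnS.
- by apply: (coef_in_contract _ (is_ideal_deg_lt p.+1)).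
- have -> : wedge b' = x k *: b - contract (c k) (wedge b).
    by rewrite -hom addrK.
  apply: coef_inB => //; first by apply: coef_in_multiple; apply: JxS.
  by apply: coef_in_sub Jcdb => _; apply: JS.
have [s [v Jv]] := coef_in_extend (idJ k) (extJ k ltkm) Jw.
exists (s + t)%N, v; apply: (coef_in_cancel (regx k ltkm)).
have -> : x k *: (D ^+ (s + t) *: b - wedge v) =
    wedge (D ^+ s *: (D ^+ t *: b' - wedge w) - x k *: v) +
    D ^+ (s + t) *: contract (c k) (wedge b).
  rewrite !(wedgeB, wedgeZ) wedge_wedge subr0 scalerA -exprD.
  rewrite scalerBr [x k *: (_ *: _)]scalerA [x k * _]mulrC -scalerA -hom.
  by rewrite scalerDr addrAC.
apply: coef_inD => //; last exact: coef_inZ.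
exact: coef_in_wedge.
Qed.

(** The coefficient of the volume element [vol] of top degree. *)
Fixpoint top n : ext n -> R :=
  if n is n'.+1 return ext n -> R then fun w => top w.2 else id.

Fixpoint vol n : ext n := if n is n'.+1 then (0, vol n') else 1.

Lemma top_scaleB n a (u v : ext n) : top (a *: u - v) = a * top u - top v.
Proof. by elim: n u v => [|n IHn] u v //=; apply: IHn. Qed.

Lemma top_coef_in (J : set R) n (w : ext n) :
  coef_in (fun=> J) w -> J (top w).
Proof. by elim: n w => [|n IHn] w //= [_ /IHn]. Qed.

Lemma top_vol n : top (vol n) = 1.
Proof. by elim: n. Qed.

Lemma wedge_vol n : wedge (vol n) = 0.
Proof. by elim: n => //= n IHn; rewrite raddf0 scaler0 IHn subr0. Qed.

(** Hence the top cohomology of the Koszul complex maps onto R modulo the ideal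
    generated by y, and its vanishing makes this the unit ideal. *)
Lemma top_wedge (J : set R) n (w : ext n) : is_ideal J ->
  (forall l, (l < n)%N -> J (y l)) -> J (top (wedge w)).
Proof.
move=> idJ; elim: n w => [|n IHn] w /= Jy; first exact: (ideal0 idJ).
rewrite top_scaleB; apply: idealB => //; last first.
  by apply: IHn => l ltln; apply/Jy/ltnW.
by rewrite mulrC; apply: idealMl => //; apply: Jy.
Qed.

End Koszul.

(** After inverting D, the ideal generated by y contains a weakly regular
    sequence that is longer than y, so it is the unit ideal: the volume element
    is a cocycle of top degree, hence a coboundary. *)
Lemma radical_of_regular_seq (R : comPzRingType) (D : R) (s y : seq R) :
  (forall k, (k < size s)%N -> forall z,
     gen_ideal [set` take k s] (s`_k * z) -> gen_ideal [set` take k s] z) ->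
  (size y < size s)%N ->
  (forall x, x \in s -> gen_ideal [set` y] (D * x)) ->
  radical (gen_ideal [set` y]) D.
Proof.
move=> regs ltys Dsy.
(* The saturations with respect to D; the sequence that lies in the ideal
   generated by y is D * s_0, D * s_1, ... *)
pose J k := [set z | exists t, gen_ideal [set` take k s] (D ^+ t * z)].
have idJ k : is_ideal (J k).
  have idG := is_ideal_gen [set` take k s].
  split=> [|u v [t Ju] [t' Jv]|a u [t Ju]].
  - by exists 0%N; rewrite mulr0; apply: ideal0.
  - exists (t + t')%N; rewrite mulrDr; apply: idealD => //.
      by rewrite addnC exprD -mulrA; apply: idealMl.
    by rewrite exprD -mulrA; apply: idealMl.
  - by exists t; rewrite mulrCA; apply: idealMl.
have /choice[c cE] k : exists c : nat -> R, (k < size s)%N ->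
    D * s`_k = \sum_(l < size y) c l * y`_l.
  have [ltks|_] := ltnP k (size s); last by exists (fun=> 0).
  by have /gen_ideal_seqP[c ->] := Dsy _ (mem_nth 0 ltks); exists c.
have subJ k z : gen_ideal [set` take k s] z -> J k z.
  by exists 0%N; rewrite mul1r.
have take_memS k x : (k < size s)%N ->
    x \in take k.+1 s = (x \in take k s) || (x == s`_k).
  by move=> ltks; rewrite (take_nth 0) // mem_rcons inE orbC.
have genS k z : (k < size s)%N ->
    gen_ideal [set` take k s] z -> gen_ideal [set` take k.+1 s] z.
  move=> ltks; apply: gen_ideal_min z; first exact: is_ideal_gen.
  by move=> z zk; apply: mem_gen_ideal; rewrite /= take_memS // zk.
have genSE k z : (k < size s)%N -> gen_ideal [set` take k.+1 s] z ->
    exists w, gen_ideal [set` take k s] (z - s`_k * w).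
  have idG := is_ideal_gen [set` take k s].
  pose H := [set z | exists w, gen_ideal [set` take k s] (z - s`_k * w)].
  move=> ltks; apply: (@gen_ideal_min _ _ H) z => [|z /=].
    split=> [|u v [w Hu] [w' Hv]|a u [w Hu]].
    - by exists 0; rewrite mulr0 subr0; apply: ideal0.
    - by exists (w + w'); rewrite mulrDr opprD addrACA; apply: idealD.
    - by exists (a * w); rewrite mulrCA -mulrBr; apply: idealMl.
  rewrite take_memS // => /orP[zk|/eqP->].
    by exists 0; rewrite mulr0 subr0; apply: mem_gen_ideal.
  by exists 1; rewrite mulr1 subrr; apply: ideal0.
have [|||||||t [w Jw]] := @koszul_exact R (nth 0 y) D J (fun k => D * s`_k) c
  (size s) (size y) idJ cE _ _ _ _ (size y).+1 0 (vol R (size y)).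
- move=> k ltks z [t Jz]; exists t.+1; apply: regs => //.
  suff -> : s`_k * (D ^+ t.+1 * z) = D ^+ t * (D * s`_k * z) by [].
  by rewrite exprSr; ring.
- by move=> k ltks z [t Jz]; exists t; apply: genS.
- move=> k ltks z; apply: subJ; rewrite mulrAC; apply: idealMl.
    exact: is_ideal_gen.
  by apply: mem_gen_ideal; rewrite /= take_memS // eqxx orbT.
- move=> k ltks z [t /(genSE _ _ ltks)[w Jw]]; exists t.+1, w.
  apply: subJ; rewrite exprS -!mulrA -mulrBr; apply: idealMl => //.
  exact: is_ideal_gen.
- by [].
- exact: deg_lt_ext.
- by rewrite wedge_vol; apply: coef_in0.
have := top_coef_in Jw; rewrite top_scaleB top_vol mulr1 => -[t' Jt].
exists (t' + t)%N; rewrite exprD.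
have idY := is_ideal_gen [set` y].
rewrite -[_ * _](subrK (D ^+ t' * top (wedge (nth 0 y) w))) -mulrBr.
apply: idealD => //.
  by move: Jt; rewrite take0; apply: gen_ideal_min.
apply: idealMl => //; apply: top_wedge => // l ltl.
by apply: mem_gen_ideal; apply: mem_nth.
Qed.

(** * Fitting ideals of an ideal *)

Section FittingIdeal.
Variables (R : comPzRingType) (I : ideal R) (P : presentation (submod_type I)).
Let r := pres_rank P.
Let A := pres_mx P.

Definition pres_gen (l : 'I_r) : R := val (pres_map P (delta_mx 0 l)).
Let a := pres_gen.

Lemma pres_gen_in l : pres_gen l \in I.
Proof. exact: (valP (pres_map P (delta_mx 0 l))). Qed.

Lemma val_pres_map v : val (pres_map P v) = \sum_l v 0 l * a l.
Proof.
rewrite [v in LHS]row_sum_delta linear_sum raddf_sum; apply: eq_bigr => l _.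
by rewrite linearZ.
Qed.

Lemma pres_gen_relation k : \sum_l A k l * a l = 0.
Proof.
have /(congr1 val) : pres_map P (row k A) = 0.
  by apply/pres_exact; exists (delta_mx 0 k); rewrite -rowE.
by rewrite val_pres_map /=; under eq_bigr do rewrite mxE.
Qed.

Lemma pres_gen_koszul i k : exists u : 'rV_(pres_nrel P),
  a k *: delta_mx 0 i - a i *: delta_mx 0 k = u *m A.
Proof.
apply/pres_exact/val_inj; rewrite linearB !linearZ /=.
by change (a k * a i + a i * - a k = 0); rewrite mulrN mulrC subrr.
Qed.

Lemma radical_sub_minors i : (0 < i)%N ->
  forall x, @radical R [set` I] x -> radical (minors_ideal (r - i) A) x.
Proof.
move=> i_gt0 x [n In]; apply: radical_radical; exists n.
have idF : is_ideal (radical (minors_ideal (r - i) A)).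
  by apply: is_ideal_radical; apply: is_ideal_gen.
have [v vE] := pres_surj P (exist _ (x ^+ n) In).
have -> : x ^+ n = \sum_l v 0 l * a l by rewrite -val_pres_map vE.
apply: ideal_sum => // l _; apply: idealMl => //.
exists (r - i)%N; apply: generator_power_minor; first exact: pres_gen_koszul.
by rewrite ltn_subrL i_gt0; apply: leq_ltn_trans (ltn_ord l).
Qed.

Lemma minors_sub_radical i s : regular_seq s -> {subset s <= I} ->
  (i < size s)%N ->
  forall x, radical (minors_ideal (r - i) A) x -> @radical R [set` I] x.
Proof.
move=> [regs _] sI ltis x [n xF]; apply: radical_radical; exists n.
have idI := is_ideal_submod I.
apply: (gen_ideal_min (is_ideal_radical idI) _ xF).
move=> {x n xF} D [f [g [homof homog DE]]].
pose y := [seq a l | l <- enum [predC codom g]].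
have Dy l : gen_ideal [set` y] (D * a l).
  by rewrite DE; apply: minor_mul_gen => k; apply: pres_gen_relation.
(* When r < i, the minor has size 0 and y consists of all r generators. *)
have szy : (size y <= i)%N.
  have injg : injective g.
    by move=> p q gpq; case: (ltngtP p q) => [/homog|/homog|/val_inj//];
      rewrite gpq ltnn.
  have : (#|codom g| + #|[predC codom g]|)%N = r.
    by rewrite -[RHS]card_ord -(cardC (mem (codom g))).
  rewrite (card_codom injg) card_ord size_map -cardE => cardg.
  by rewrite -(leq_add2l (r - i)) cardg addnC -leq_subLR.
have [||x xs|n yD] := @radical_of_regular_seq R D s y.
- by [].
- exact: leq_ltn_trans ltis.
- have [v vE] := pres_surj P (exist _ x (sI x xs)).
  have -> : x = \sum_l v 0 l * a l by rewrite -val_pres_map vE.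
  have idY := is_ideal_gen [set` y].
  rewrite mulr_sumr; apply: (ideal_sum _ idY) => l _.
  by rewrite mulrCA; apply: idealMl.
exists n; apply: (gen_ideal_min idI) yD => z /= /mapP[l _ ->].
exact: pres_gen_in.
Qed.

End FittingIdeal.

Theorem corollary1p3 (R : comPzRingType) (noethR : noetherian R)
    (I : ideal R) (j : nat) (gradeI : has_grade I j)
    (i : nat) (hi : (1 <= i <= j - 1)%N) :
  radical (Fitt i (submod_type I)) = @radical R [set` I].
Proof.
have [s [regs sI _] szs] := gradeI.
case/andP: hi => i_gt0 lt_ij.
have [P] := presentation_exists noethR I.
have [Q ->] : exists Q : presentation (submod_type I),
    Fitt i (submod_type I) = minors_ideal (pres_rank Q - i) (pres_mx Q).
  rewrite /Fitt; set F := [set J | _]; apply: (@xgetPex _ set0 F).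
  by exists (minors_ideal (pres_rank P - i) (pres_mx P)), P.
apply/seteqP; split=> x.
  apply: (minors_sub_radical regs sI); rewrite szs.
  by move: i_gt0 lt_ij; lia.
exact: radical_sub_minors.
Qed.
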